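(* Let $X$ be a complex Banach space and let $A:D(A)\subset X\to X$ be the generator of an immediately differentiable, uniformly exponentially stable $C_0$-semigroup $(e^{tA})_{t\ge0}$ on $X$. Let $B\in\mathcal L(X)$ be a bounded linear operator such that $Be^{tA}$ is compact for all $t>0$. If the $C_0$-semigroup $(e^{t(A+B)})_{t\ge0}$ generated by $A+B$ is strongly stable, then it is uniformly exponentially stable.
   Context: A $C_0$-semigroup $(T(t))_{t\ge0}$ is immediately differentiable if $t\mapsto T(t)x$ is differentiable on $(0,\infty)$ for every $x\in X$. The operator $A+B$ has domain $D(A+B)=D(A)$. A $C_0$-semigroup $(T(t))_{t\ge0}$ is strongly stable if $\lim_{t\to\infty}\|T(t)x\|=0$ for all $x\in X$, and uniformly exponentially stable if there are $M\ge1$, $\omega>0$ with $\|T(t)\|_{\mathcal L(X)}\le Me^{-\omega t}$ for all $t\ge0$. *)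

(* Defs.v *)
From HB Require Import structures.
From mathcomp Require Import all_boot all_order all_algebra.
From mathcomp Require Import complex.
From mathcomp Require Import all_classical all_reals all_analysis.

Set Implicit Arguments.
Unset Strict Implicit.
Unset Printing Implicit Defensive.

Import Order.TTheory GRing.Theory Num.Theory numFieldNormedType.Exports.

Local Open Scope classical_set_scope.
Local Open Scope ring_scope.
Local Open Scope complex_scope.

Section Operators.
Context {R : realType} {X : completeNormedModType R[i]}.

(* The norm of X takes its values in R[i]; they are real and nonnegative, so
   the real part is the usual real-valued norm. *)
Definition rnorm (x : X) : R := complex.Re `|x|.

(* For a linear map, bounded on a neighbourhood of 0 iff |f x| <= M |x| for
   some M (linear_boundedP) iff continuous (linear_bounded_continuous). *)
Definition bounded_operator (f : {linear X -> X}) : Prop :=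
  bounded_near f (nbhs (0 : X)).

(* Meaningful for bounded operators only: sup is 0 on unbounded sets. *)
Definition opnorm (f : {linear X -> X}) : R :=
  sup [set rnorm (f x) | x in [set x | rnorm x <= 1]].

Definition compact_operator (f : X -> X) : Prop :=
  precompact (f @` [set x | rnorm x <= 1]).

(* A possibly unbounded operator X ⊇ dom -> X; the values of op outside dom
   carry no information. *)
Record operator := Operator { dom : set X ; op : X -> X }.

Definition add_bounded (A : operator) (B : {linear X -> X}) : operator :=
  Operator (dom A) (fun x => op A x + B x).

(* One-parameter families are indexed by all of R, but only their values at
   t >= 0 are ever constrained or used. *)
Definition C0_semigroup (T : R -> {linear X -> X}) : Prop :=
  [/\ forall t : R, 0 <= t -> bounded_operator (T t),
      forall x, T 0 x = x,
      forall (s t : R) x, 0 <= s -> 0 <= t -> T (s + t) x = T s (T t x)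
    & forall x, T t x @[t --> (0 : R)^'+] --> x].

(* X is a module over R[i] while time is real, hence difference quotients
   rather than derivable. *)
Definition generates (A : operator) (T : R -> {linear X -> X}) : Prop :=
  (forall x, dom A x <-> cvg ((h^-1)%:C *: (T h x - x) @[h --> (0 : R)^'+])) /\
  (forall x, dom A x -> (h^-1)%:C *: (T h x - x) @[h --> (0 : R)^'+] --> op A x).

Definition immediately_differentiable (T : R -> {linear X -> X}) : Prop :=
  forall x (t : R), 0 < t ->
    cvg ((h^-1)%:C *: (T (t + h) x - T t x) @[h --> (0 : R)^']).

Definition strongly_stable (T : R -> {linear X -> X}) : Prop :=
  forall x, rnorm (T t x) @[t --> +oo] --> (0 : R).

Definition uniformly_exponentially_stable (T : R -> {linear X -> X}) : Prop :=
  exists M omega : R, [/\ 1 <= M, 0 < omega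
    & forall t : R, 0 <= t -> opnorm (T t) <= M * expR (- omega * t)].

End Operators.

Arguments operator {R} X.

(* Main.v *)
Require Import Defs.
From HB Require Import structures.
From mathcomp Require Import all_boot all_order all_algebra.
From mathcomp Require Import complex ring lra.
From mathcomp Require Import all_classical all_reals all_analysis.
Import Order.TTheory GRing.Theory Num.Theory numFieldNormedType.Exports.
Local Open Scope classical_set_scope.
Local Open Scope ring_scope.
Local Open Scope complex_scope.
Set Implicit Arguments.
Unset Strict Implicit.

(** Write M for a bound of all S t and of all T t, put a = ||B||, and let
    ||T t|| <= M exp(- w t).  Fix a vector x of the unit ball, a time t, and
    consider the interpolation f s = S (t - s) (T s x) between f 0 = S t x and
    f t = T t x.  Differentiability of T puts T s x in the domain of A for
    every s > 0, so that the two generators differ on it by B and f has the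
    right derivative - S (t - s) (B (T s x)).  The mean value inequality thus
    bounds increments of f by values of S (t - s) (B (T s x)): this replaces
    the integral in Duhamel's formula ([interpolation_lipschitz]).

    Now let t = t0 + N, and cut [0, N] at a small d > 0.
    - On [0, d] the increment of f is at most M ^ 2 a d.
    - On [d, N] the vector B (T s x) = (B \o T d) (T (s - d) x) lies in a fixed
      multiple of the image of the unit ball under the compact operator
      B \o T d, whatever s and x are.  The operators S r are uniformly bounded
      and tend to 0 strongly, hence uniformly on precompact sets
      ([stable_uniformly_on_precompact]), and r = t - s >= t0 is large.
    - At the end, f N = S t0 (T N x) is at most M ^ 2 exp(- w N).
    Choosing N, then d, then t0 makes ||S t|| as small as desired
    ([exists_small_opnorm]), and a semigroup with one value of norm less than 1
    decays exponentially ([exponentially_stable_of_contraction]).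

    That M exists for S is the uniform boundedness principle, used once near
    time 0 and once on the whole half-line ([strongly_stable_bounded]).  The
    space has complex scalars; [uniform_boundedness] is proved for it by a
    gliding hump argument (A. Sokal, A really simple elementary proof of the
    uniform boundedness theorem, 2011), which needs only completeness. *)

(** * Real-valued norm and operator norm *)

Lemma near_right0P (R : realType) (P : R -> Prop) :
  (\forall h \near 0^'+, P h) <->
  exists2 d : R, 0 < d & forall h, 0 < h < d -> P h.
Proof.
split=> [/nbhs_ballP [d /= d0 dP]|[d d0 dP]].
  exists d => // h /andP [h0 hd]; apply: dP => //.
  by rewrite /ball /= sub0r normrN gtr0_norm.
near=> h; apply: dP; apply/andP; split; near: h.
  exact: nbhs_right_gt.
exact: nbhs_right_lt.
Unshelve. all: by end_near. Qed.

Section Norm.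
Context {R : realType} {X : completeNormedModType R[i]}.
Implicit Types (x y : X) (f : {linear X -> X}) (a b r c : R).

Lemma rnormE x : `|x| = (rnorm x)%:C.
Proof. by rewrite /rnorm RRe_real // normr_real. Qed.

Lemma rnorm_ge0 x : 0 <= rnorm x.
Proof. by rewrite -ler0c -rnormE. Qed.

Lemma rnorm0 : rnorm (0 : X) = 0.
Proof. by rewrite /rnorm normr0. Qed.

Lemma rnormN x : rnorm (- x) = rnorm x.
Proof. by rewrite /rnorm normrN. Qed.

Lemma rnormB x y : rnorm (x - y) = rnorm (y - x).
Proof. by rewrite -rnormN opprB. Qed.

Lemma rnormD x y : rnorm (x + y) <= rnorm x + rnorm y.
Proof. by rewrite -lecR [leRHS]rmorphD /= -!rnormE ler_normD. Qed.

Lemma rnormZ a x : rnorm (a%:C *: x) = `|a| * rnorm x.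
Proof.
apply: complexI; rewrite [RHS]rmorphM /= -!rnormE normrZ; congr (_ * _).
by rewrite normc_def /= expr0n addr0 sqrtr_sqr.
Qed.

(** The norm of X is complex-valued, so the radii in the library's convergence
    criteria are complex; this is the form with real radii. *)
Lemma rnorm_cvgP (T : Type) (F : set_system T) (FF : Filter F) (g : T -> X) x :
  g @ F --> x <-> forall e : R, 0 < e -> \forall t \near F, rnorm (g t - x) < e.
Proof.
split=> [/cvgrPdistC_lt gx e e0|gx].
  have := gx e%:C; rewrite ltcR => /(_ e0); apply: filterS => t.
  by rewrite rnormE ltcR.
apply/cvgrPdistC_lt => e e0.
have eE : e = (complex.Re e)%:C by rewrite RRe_real // gtr0_real.
move: e0; rewrite eE ltcR => /gx; apply: filterS => t.
by rewrite rnormE ltcR.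
Qed.

Lemma opnorm_le f r : (forall x, rnorm x <= 1 -> rnorm (f x) <= r) ->
  opnorm f <= r.
Proof.
move=> fr; apply: ge_sup => [|_ [x x1 <-]]; last exact: fr.
by exists (rnorm (f 0)), 0 => //=; rewrite rnorm0.
Qed.

Lemma opnorm_ub f x : bounded_operator f -> rnorm x <= 1 ->
  rnorm (f x) <= opnorm f.
Proof.
move=> /bounded_funP /(_ 1) [M fM] x1; apply: ub_le_sup; last by exists x.
have M_real : M \is Num.real by apply: ger0_real; apply: le_trans (fM 0 _); rewrite ?normr0.
exists (complex.Re M) => _ [y y1 <-].
by rewrite -lecR (RRe_real M_real) -rnormE fM // rnormE lecR.
Qed.

Lemma rnorm_le_opnorm f x : bounded_operator f ->
  rnorm (f x) <= opnorm f * rnorm x.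
Proof.
move=> fb; have [x0|x0] := eqVneq (rnorm x) 0.
  have -> : x = 0 by apply/eqP; rewrite -normr_eq0 rnormE x0.
  by rewrite linear0 rnorm0 mulr0.
have xp : 0 < rnorm x by rewrite lt_def x0 rnorm_ge0.
have := @opnorm_ub f ((rnorm x)^-1%:C *: x) fb.
rewrite linearZ /= !rnormZ gtr0_norm ?invr_gt0 // mulVf // => /(_ (lexx _)).
by rewrite ler_pdivrMl // mulrC.
Qed.

Lemma opnorm_ge0 f : 0 <= opnorm f.
Proof.
have [fb|fb] := pselect (has_sup [set rnorm (f x) | x in [set x | rnorm x <= 1]]).
  apply: le_trans (rnorm_ge0 (f 0)) _; apply: sup_upper_bound => //=.
  by exists 0 => //=; rewrite rnorm0.
by rewrite /opnorm sup_out.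
Qed.

Lemma opnorm_gt f r : r < opnorm f -> exists2 x, rnorm x <= 1 & r < rnorm (f x).
Proof.
move=> rf; apply: contrapT => fr; move: rf; apply/negP; rewrite -leNgt.
apply: opnorm_le => x x1; rewrite leNgt; apply/negP => rfx.
by apply: fr; exists x.
Qed.

End Norm.

(** * Uniform boundedness principle *)

Section Uniform_boundedness.
Context {R : realType} {X : completeNormedModType R[i]}.

Lemma geometric_steps_limit (u : nat -> X) :
  (forall n, rnorm (u n.+1 - u n) <= 3^-1 ^+ n) ->
  exists l, forall n, rnorm (l - u n) <= 3 / 2 * 3^-1 ^+ n.
Proof.
move=> ustep.
have tail n k : rnorm (u (n + k)%N - u n) <= 3 / 2 * (3^-1 ^+ n - 3^-1 ^+ (n + k)).
  elim: k => [|k IH]; first by rewrite addn0 !subrr rnorm0 mulr0.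
  rewrite addnS -(subrKA (u (n + k)%N)) (le_trans (rnormD _ _)) //.
  have := lerD (ustep (n + k)%N) IH; rewrite exprS => /le_trans; apply.
  lra.
have tail' n m : (n <= m)%N -> rnorm (u m - u n) <= 3 / 2 * 3^-1 ^+ n.
  move=> /subnKC <-; apply: le_trans (tail _ _) _.
  by rewrite ler_wpM2l ?gerBl ?exprn_ge0.
have small (e : R) : 0 < e -> \forall n \near \oo, 3 / 2 * 3^-1 ^+ n < e.
  move=> e0; have : (fun n => 3 / 2 * 3^-1 ^+ n) @ \oo --> (3 / 2 * 0 : R).
    by apply: cvgMr; apply: cvg_expr; rewrite ger0_norm ?invr_ge0 // invf_lt1 // ltr1n.
  rewrite mulr0 => /cvgr0_norm_lt /(_ _ e0); apply: filterS => n.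
  exact: le_lt_trans (ler_norm _).
have ucvg : cvg (u @ \oo).
  apply/cauchy_cvgP/cauchy_exP => e e0.
  have eE : e = (complex.Re e)%:C by rewrite RRe_real // gtr0_real.
  move: e0; rewrite eE ltcR => /small [N _ /(_ N (leqnn _)) uN].
  exists (u N), N => // m /= Nm; rewrite -ball_normE /ball_ /= rnormE ltcR rnormB.
  exact: le_lt_trans (tail' _ _ Nm) uN.
exists (lim (u @ \oo)) => n; apply/ler_addgt0Pr => e e0.
have /(rnorm_cvgP (F := \oo)) /(_ e e0) [N _ uN] := ucvg.
rewrite -(subrKA (u (maxn n N))) (le_trans (rnormD _ _)) // addrC lerD //.
  by rewrite tail' // leq_maxl.
by rewrite rnormB ltW // uN //= leq_maxr.
Qed.

(** The values of f at x + r z and x - r z differ by 2 r f z, so one of them has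
    norm at least r ||f z||; take z in the unit ball nearly attaining the norm
    of f. *)
Lemma large_value_nearby (f : {linear X -> X}) (x : X) (r c : R) :
  0 <= r -> c < opnorm f ->
  exists y, rnorm (y - x) <= r /\ r * c <= rnorm (f y).
Proof.
move=> r0 /opnorm_gt [z z1 cz].
have [fx|fx] := leP (r * c) (rnorm (f (x + r%:C *: z))).
  exists (x + r%:C *: z); split=> //.
  by rewrite addrC addKr rnormZ ger0_norm // ler_piMr.
exists (x - r%:C *: z); split.
  by rewrite addrC addKr rnormN rnormZ ger0_norm // ler_piMr.
have fz : r * c <= rnorm (f (r%:C *: z)).
  by rewrite linearZ rnormZ ger0_norm // ler_wpM2l // ltW.
have : 2 * rnorm (f (r%:C *: z)) <= rnorm (f (x + r%:C *: z)) + rnorm (f (x - r%:C *: z)).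
  have -> : 2 * rnorm (f (r%:C *: z)) = rnorm (f (x + r%:C *: z) - f (x - r%:C *: z)).
    rewrite -linearB opprB addrC addrA subrK linearD -{2 3}[f _]scale1r -scalerDl.
    by rewrite -(rmorph1 (real_complex R)) -rmorphD rnormZ ger0_norm.
  by rewrite -(rnormN (f (x - _))) rnormD.
lra.
Qed.

(** If the norms are unbounded, choose operators f_n with ||f_n|| > n 3^n and
    move from u_n to u_(n+1) by at most 3^-n so that ||f_n u_(n+1)|| is at least
    (2/3) 3^-n ||f_n||.  All later moves together change f_n u_(n+1) by at most
    (1/2) 3^-n ||f_n||, so at the limit l the norm ||f_n l|| is at least
    3^-n ||f_n|| / 6 > n / 6. *)
Lemma uniform_boundedness (I : Type) (F : I -> {linear X -> X}) :
  (forall i, bounded_operator (F i)) ->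
  (forall x, exists M, forall i, rnorm (F i x) <= M) ->
  exists M, forall i, opnorm (F i) <= M.
Proof.
move=> Fb Fpt; apply: contrapT => /forallNP unb.
have /choice [i iP] n : exists i, n%:R * 3 ^+ n < opnorm (F i).
  have /existsNP [i /negP] := unb (n%:R * 3 ^+ n).
  by rewrite -ltNge; exists i.
have op0 n : 0 < opnorm (F (i n)) by apply: le_lt_trans (iP n); rewrite mulr_ge0 ?exprn_ge0.
have /choice [step stepP] : forall nx : nat * X, exists y,
    rnorm (y - nx.2) <= 3^-1 ^+ nx.1 /\
    3^-1 ^+ nx.1 * (2 / 3 * opnorm (F (i nx.1))) <= rnorm (F (i nx.1) y).
  move=> [n x] /=; apply: large_value_nearby; first by rewrite exprn_ge0.
  by have := op0 n; lra.
pose fix u n := if n is m.+1 then step (m, u m) else 0.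
have [l lP] := @geometric_steps_limit u (fun n => (stepP (n, u n)).1).
have [M MP] := Fpt l.
have low n : n%:R / 6 <= M.
  apply: le_trans (MP (i n)).
  have := (stepP (n, u n)).2; rewrite -[step (n, u n)]/(u n.+1).
  have : rnorm (F (i n) (u n.+1)) <= rnorm (F (i n) l) + rnorm (F (i n) (u n.+1 - l)).
    by rewrite linearB (le_trans _ (rnormD _ _)) // addrC subrK.
  have := @rnorm_le_opnorm _ _ (F (i n)) (u n.+1 - l) (Fb _).
  have := ler_wpM2l (ltW (op0 n)) (lP n.+1); rewrite (rnormB l) exprS.
  have : n%:R <= 3^-1 ^+ n * opnorm (F (i n)).
    by rewrite exprVn ler_pdivlMl ?exprn_gt0 // mulrC ltW.
  lra.
have := low (Num.truncn (6 * M)).+1; have := truncnS_gt (6 * M); lra.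
Qed.

End Uniform_boundedness.

(** * Mean value inequality for right derivatives *)

Section Mean_value.
Context {R : realType} {X : completeNormedModType R[i]}.

(** The first hypothesis carries P to the supremum of the c for which P holds on
    [a, c[; the second moves past it unless it is b. *)
Lemma real_induction (P : R -> Prop) (a b : R) :
  (forall s, a <= s <= b -> (forall r, a <= r < s -> P r) -> P s) ->
  (forall s, a <= s < b -> P s -> \forall h \near 0^'+, P (s + h)) ->
  forall s, a <= s <= b -> P s.
Proof.
move=> Pl Pr s sab; have ab : a <= b by case/andP: sab => /le_trans; apply.
pose E := [set c | a <= c <= b /\ forall r, a <= r < c -> P r].
have Ea : E a.
  by split=> [|r /andP [ar /(le_lt_trans ar)]]; rewrite ?lexx ?ltxx.
have supE : has_sup E by split; [exists a|exists b => c [/andP []]].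
set c := sup E.
have ac : a <= c by exact: sup_upper_bound.
have cb : c <= b by apply: ge_sup; [exists a|move=> ? [/andP []]].
have Ec r : a <= r < c -> P r.
  move=> /andP [ar rc]; have [e [_ eP] re] := sup_gt supE.1 rc.
  by apply: eP; rewrite ar.
have Pc : P c by apply: Pl => //; apply/andP.
have [bc|cltb] := leP b c.
  have cE : c = b by apply/le_anti/andP.
  move: sab => /andP [as_]; rewrite le_eqVlt => /predU1P [->|sb]; first by rewrite -cE.
  by apply: Ec; rewrite as_ cE.
have /near_right0P [d d0 dP] : \forall h \near 0^'+, P (c + h).
  by apply: Pr => //; rewrite ac.
pose h := Num.min d (b - c) / 2.
have [h0 hd hb] : [/\ 0 < h, h < d & c + h <= b].
  by rewrite /h; case: (leP d (b - c)) => ?; split; lra.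
suff : E (c + h) by move/(sup_upper_bound supE); rewrite -/c; lra.
split=> [|r /andP [ar rch]]; first by lra.
have [rc|cr|->//] := ltgtP r c; first by apply: Ec; rewrite ar.
by rewrite -(subrKC c r); apply: dP; lra.
Qed.

(** Only right difference quotients are controlled inside the interval, which
    is what the generators give; left continuity closes up the interval on
    which the estimate holds. *)
Lemma mean_value_inequality (f : R -> X) (a b C : R) : a <= b -> 0 <= C ->
  f (a + h) @[h --> 0^'+] --> f a ->
  (forall s, a < s <= b -> f (s - h) @[h --> 0^'+] --> f s) ->
  (forall s, a < s < b -> forall e, 0 < e ->
     \forall h \near 0^'+, rnorm (f (s + h) - f s) <= (C + e) * h) ->
  rnorm (f b - f a) <= C * (b - a).
Proof.
move=> ab C0 fa fl fr; apply/ler_addgt0Pr => e0 e0_gt0.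
(* The slope C + e leaves room for the error of the difference quotients, and
   the additive e for the step out of a, where no derivative is available. *)
pose e := e0 / (b - a + 1).
have e_gt0 : 0 < e by rewrite divr_gt0 //; lra.
suff /(_ b) : forall s, a <= s <= b -> rnorm (f s - f a) <= (C + e) * (s - a) + e.
  rewrite ab lexx => /(_ isT) /le_trans; apply.
  rewrite mulrDl -addrA lerD2l -{2}[e]mulr1 -mulrDr divfK //; lra.
apply: real_induction => [s|s].
  move=> /andP []; rewrite le_eqVlt => /predU1P [<- _ _|as_ sb IH].
    by rewrite !subrr rnorm0 mulr0 add0r ltW.
  apply/ler_addgt0Pr => eta eta0.
  have /rnorm_cvgP /(_ eta eta0) /near_right0P [d d0 dP] : f (s - h) @[h --> 0^'+] --> f s.
    by apply: fl; rewrite as_.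
  pose h := Num.min d (s - a) / 2.
  have [h0 hd ha] : [/\ 0 < h, h < d & a <= s - h].
    by rewrite /h; case: (leP d (s - a)) => ?; split; lra.
  have := IH (s - h); have := dP h.
  rewrite -(subrKA (f (s - h)) (f s)) h0 hd ha => /(_ isT).
  rewrite rnormB => fsh /(_ ltac:(lra)) fha.
  have := rnormD (f s - f (s - h)) (f (s - h) - f a).
  have : 0 <= (C + e) * h by rewrite mulr_ge0 //; lra.
  lra.
move=> /andP []; rewrite le_eqVlt => /predU1P [<- _ _|as_ sb IH].
  have /rnorm_cvgP /(_ e e_gt0) := fa; apply: filterS2 (nbhs_right_gt 0) => h h0 fh.
  have : 0 <= (C + e) * h by rewrite mulr_ge0 //; lra.
  lra.
have := fr s _ e e_gt0; rewrite as_ => /(_ sb); apply: filterS => h fh.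
have := rnormD (f (s + h) - f s) (f s - f a).
rewrite subrKA; lra.
Qed.

End Mean_value.

(** * Bounds for strongly continuous semigroups *)

Section Semigroups.
Context {R : realType} {X : completeNormedModType R[i]}.
Implicit Types (S T : R -> {linear X -> X}).

Lemma opnorm_comp_le (f g h : {linear X -> X}) (a b : R) :
  bounded_operator f -> bounded_operator g -> (forall x, h x = f (g x)) ->
  opnorm f <= a -> opnorm g <= b -> opnorm h <= a * b.
Proof.
move=> fb gb hE fa gb'; apply: opnorm_le => x x1; rewrite hE.
apply: le_trans (rnorm_le_opnorm _ fb) _.
apply: ler_pM => //; [exact: opnorm_ge0|exact: rnorm_ge0|].
exact: le_trans (opnorm_ub gb x1) gb'.
Qed.

(** Otherwise there are t_n -> 0 with ||S t_n|| > n; but S t_n x -> x, so the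
    uniform boundedness principle bounds these norms. *)
Lemma C0_semigroup_bounded_near0 S : C0_semigroup S ->
  exists2 d : R, 0 < d & exists M, forall t, 0 <= t <= d -> opnorm (S t) <= M.
Proof.
case=> Sb S0 _ Sc; apply: contrapT => unb.
have /choice [t tP] n : exists t, 0 <= t < n.+1%:R^-1 /\ n%:R < opnorm (S t).
  apply: contrapT => /forallNP bdd; apply: unb; exists (n.+1%:R^-1 / 2) => //.
  exists n%:R => t /andP [t0 tn]; rewrite leNgt; apply/negP => nS.
  apply: (bdd t); split=> //; rewrite t0 (le_lt_trans tn) // ltr_pdivrMr //.
  by rewrite ltr_pMr ?ltr1n // invr_gt0.
have [||M MP] := @uniform_boundedness _ _ _ (fun n => S (t n)).
- by move=> n; apply: Sb; have [/andP []] := tP n.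
- move=> x.
  have /rnorm_cvgP /(_ 1 ltr01) /near_right0P [d d0 dP] := Sc x.
  pose N := Num.truncn d^-1.
  exists (Num.max (1 + rnorm x) (\big[Num.max/0]_(i < N) rnorm (S (t i) x))) => n.
  rewrite le_max; have [nN|Nn] := ltnP n N.
    by rewrite (le_bigmax _ (fun i : 'I_N => rnorm (S (t i) x)) (Ordinal nN)) orbT.
  apply/orP; left; have [/andP [t0 tn] _] := tP n.
  move: t0; rewrite le_eqVlt => /predU1P [<-|t0]; first by rewrite S0 lerDr.
  have := rnormD (S (t n) x - x) x; rewrite subrK => /le_trans; apply.
  rewrite lerD2r ltW // dP // t0 (lt_le_trans tn) //.
  rewrite invf_ple ?posrE // ltW // (lt_le_trans (truncnS_gt _)) //.
  by rewrite ler_nat ltnS.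
have [_ ] := tP (Num.truncn M).+1; rewrite ltNge => /negP; apply.
by rewrite (le_trans (MP _)) // ltW // truncnS_gt.
Qed.

Lemma C0_semigroup_locally_bounded S : C0_semigroup S ->
  forall t0 : R, exists M, forall t, 0 <= t <= t0 -> opnorm (S t) <= M.
Proof.
move=> SC t0; have [Sb _ SD _] := SC.
have [d d0 [M0 MP]] := C0_semigroup_bounded_near0 SC.
pose M := Num.max 1 M0; have M1 : 1 <= M by rewrite le_max lexx.
have step n t : 0 <= t <= n%:R * d -> opnorm (S t) <= M ^+ n.+1.
  elim: n t => [|n IH] t /andP [t_ge0].
    rewrite mul0r => t_le0.
    by rewrite expr1 le_max MP ?orbT // t_ge0 (le_trans t_le0 (ltW d0)).
  have [td _|dt tn] := leP t d.
    rewrite exprS (le_trans (MP t _)) ?t_ge0 // -[M0]mulr1 ler_pM //.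
      by apply: le_trans (opnorm_ge0 _) (MP t _); rewrite t_ge0.
      by rewrite le_max lexx orbT.
    exact: exprn_ege1.
  rewrite exprS; apply: (@opnorm_comp_le (S d) (S (t - d))).
  - exact/Sb/ltW.
  - by apply: Sb; lra.
  - by move=> x; rewrite -SD ?subrKC //; lra.
  - by rewrite le_max MP ?orbT // lexx ltW.
  - by apply: IH; move: tn; rewrite -natr1 mulrDl mul1r; lra.
exists (M ^+ (Num.truncn (t0 / d)).+2) => t /andP [t_ge0 tt0].
apply: step; rewrite t_ge0 (le_trans tt0) // -ler_pdivrMr // ltW //.
exact: truncnS_gt.
Qed.

(** Each orbit is bounded: for large times it is close to 0, and before that
    the semigroup itself is bounded. *)
Lemma strongly_stable_bounded S : C0_semigroup S -> strongly_stable S ->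
  exists2 M, 1 <= M & forall t, 0 <= t -> opnorm (S t) <= M.
Proof.
move=> SC Ss; have [Sb _ _ _] := SC.
have [||M MP] := @uniform_boundedness _ _ _ (fun t : R => S `|t|).
- by move=> t; apply: Sb.
- move=> x; have /cvgr0_norm_lt /(_ 1 ltr01) [t0 [_ t0P]] := Ss x.
  have [M MP] := C0_semigroup_locally_bounded SC t0.
  exists (Num.max 1 (M * rnorm x)) => t; rewrite le_max.
  have [tt0|t0t] := leP `|t| t0; last first.
    by rewrite (le_trans (ler_norm _)) // ltW // t0P.
  rewrite orbC (le_trans (rnorm_le_opnorm x (Sb _ _))) //.
  by rewrite ler_wpM2r ?rnorm_ge0 // MP // tt0 andbT.
exists (Num.max 1 M) => [|t t0]; first by rewrite le_max lexx.
by rewrite le_max -(ger0_norm t0) MP orbT.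
Qed.

(** For t = r + n t1 with 0 <= r < t1, the norm of S t is at most M exp(- n),
    and n > t / t1 - 1. *)
Lemma exponentially_stable_of_contraction S (M t1 : R) :
  C0_semigroup S -> 1 <= M -> (forall t, 0 <= t -> opnorm (S t) <= M) ->
  0 < t1 -> opnorm (S t1) <= expR (-1) -> uniformly_exponentially_stable S.
Proof.
move=> [Sb _ SD _] M1 MP t10 St1.
have M0 : 0 <= M by lra.
have iter n t : 0 <= t -> opnorm (S (t + n%:R * t1)) <= expR (- n%:R) * M.
  move=> t0; elim: n => [|n IH].
    by rewrite mul0r addr0 oppr0 expR0 mul1r MP.
  have -> : expR (- n.+1%:R) * M = expR (-1) * (expR (- n%:R) * M).
    by rewrite mulrA -expRD -natr1 opprD addrC.
  have nt1 : 0 <= t + n%:R * t1 by rewrite addr_ge0 // mulr_ge0 // ltW.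
  apply: (opnorm_comp_le (Sb _ (ltW t10)) (Sb _ nt1)) => // x.
  rewrite -SD // ?ltW // -natr1; congr (S _ x); ring.
exists (M * expR 1), t1^-1; split; first last.
- move=> t t0; pose n := Num.truncn (t / t1).
  have /truncn_itv /andP [nt tn] : 0 <= t / t1 by rewrite divr_ge0 // ltW.
  have tt1 : n%:R * t1 <= t by rewrite -ler_pdivlMr.
  rewrite -[in S _](subrK (n%:R * t1) t) (le_trans (iter _ _ _)) ?subr_ge0 //.
  rewrite mulrC -mulrA ler_wpM2l // -expRD ler_expR.
  move: tn; rewrite -/n -natr1 mulNr mulrC; lra.
- by rewrite invr_gt0.
- by rewrite mulr_ege1 // -expR0 ler_expR.
Qed.

(** The right difference quotient of T at t, applied to x, is the one at 0
    applied to T t x. *)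
Lemma immediately_differentiable_dom (A : operator X) T : C0_semigroup T ->
  generates A T -> immediately_differentiable T ->
  forall x (t : R), 0 < t -> dom A (T t x).
Proof.
move=> [_ _ TD _] [domA _] Td x t t0; apply/domA.
have /cvg_ex [l lP] := Td x t t0.
apply/cvg_ex; exists l.
have : (h^-1)%:C *: (T (t + h) x - T t x) @[h --> (0 : R)^'+] --> l.
  exact: cvg_dnbhs_at_right.
apply: cvg_trans; apply: near_eq_cvg; near=> h.
have h0 : 0 < h by near: h; exact: nbhs_right_gt.
by rewrite [t + h]addrC TD // ltW.
Unshelve. all: by end_near. Qed.

Lemma perturbation_difference_quotient (A : operator X) T (B : {linear X -> X}) S y :
  generates A T -> generates (add_bounded A B) S -> dom A y ->
  (h^-1)%:C *: (T h y - S h y) @[h --> (0 : R)^'+] --> - B y.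
Proof.
move=> [_ TA] [_ SAB] yA.
have -> : - B y = op A y - (op A y + B y) by rewrite opprD addNKr.
have -> : (fun h : R => (h^-1)%:C *: (T h y - S h y)) =
    (fun h => (h^-1)%:C *: (T h y - y) - (h^-1)%:C *: (S h y - y)).
  by apply/funext => h; rewrite -scalerBr opprB addrA subrK.
by apply: cvgB; [exact: TA|exact: SAB].
Qed.

(** At each y of the closure, smallness of S t y for large t extends to a
    neighbourhood of y, because the S t are equicontinuous; finitely many such
    neighbourhoods cover the compact closure. *)
Lemma stable_uniformly_on_precompact S (M : R) (K : set X) (e : R) :
  C0_semigroup S -> (forall t, 0 <= t -> opnorm (S t) <= M) ->
  strongly_stable S -> precompact K -> 0 < e ->
  exists2 t0, 0 <= t0 & forall t y, t0 <= t -> K y -> rnorm (S t y) <= e.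
Proof.
move=> [Sb _ _ _] MP Ss; rewrite precompactE => /compact_near_coveringP Kc e0.
have M0 : 0 <= M by apply: le_trans (opnorm_ge0 _) (MP 0 _).
have M2 : 0 < 2 * (M + 1) by lra.
have [|t0 [_ t0P]] := Kc R +oo (fun t y => 0 <= t -> rnorm (S t y) <= e) _.
  move=> y _.
  exists ([set y' | rnorm (y' - y) < e / (2 * (M + 1))], [set t | rnorm (S t y) < e / 2]).
    split=> /=.
      by have /rnorm_cvgP /(_ _ (divr_gt0 e0 M2)) := @cvg_id _ (nbhs y).
    have /cvgr0_norm_lt := Ss y; move=> /(_ (e / 2) (divr_gt0 e0 (ltr0Sn _ 1))).
    by apply: filterS => t; rewrite ger0_norm ?rnorm_ge0.
  move=> [y' t] /= [yy' Sty] t_ge0; rewrite -(subrK y y') linearD.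
  apply: le_trans (rnormD _ _) _.
  have := rnorm_le_opnorm (y' - y) (Sb t t_ge0).
  have : opnorm (S t) * rnorm (y' - y) <= (M + 1) * (e / (2 * (M + 1))).
    apply: ler_pM; rewrite ?opnorm_ge0 ?rnorm_ge0 ?(ltW yy') //.
    by have := MP t t_ge0; lra.
  have -> : (M + 1) * (e / (2 * (M + 1))) = e / 2 by field; lra.
  lra.
exists (Num.max 0 (t0 + 1)) => [|t y]; first by rewrite le_max lexx.
rewrite ge_max => /andP [t_ge0 tt0] Ky; apply: t0P => //.
  by rewrite (lt_le_trans _ tt0) // ltrDl.
exact: subset_closure.
Qed.
End Semigroups.

(** * Comparison of a semigroup with its bounded perturbation *)

Section Comparison.
Context {R : realType} {X : completeNormedModType R[i]}.
Variables (A : operator X) (B : {linear X -> X}) (T S : R -> {linear X -> X}).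
Variables (MS MT : R).
Hypotheses (T_C0 : C0_semigroup T) (S_C0 : C0_semigroup S).
Hypotheses (A_gen : generates A T) (AB_gen : generates (add_bounded A B) S).
Hypothesis T_dom : forall x (t : R), 0 < t -> dom A (T t x).
Hypotheses (MS_ge0 : 0 <= MS) (MT_ge0 : 0 <= MT).
Hypothesis S_le : forall t : R, 0 <= t -> opnorm (S t) <= MS.
Hypothesis T_le : forall t : R, 0 <= t -> opnorm (T t) <= MT.

Let rnorm_S (t : R) x : 0 <= t -> rnorm (S t x) <= MS * rnorm x.
Proof.
move=> t0; have [Sb _ _ _] := S_C0.
by rewrite (le_trans (rnorm_le_opnorm x (Sb t t0))) // ler_wpM2r ?rnorm_ge0 ?S_le.
Qed.

Let rnorm_T (t : R) x : 0 <= t -> rnorm (T t x) <= MT * rnorm x.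
Proof.
move=> t0; have [Tb _ _ _] := T_C0.
by rewrite (le_trans (rnorm_le_opnorm x (Tb t t0))) // ler_wpM2r ?rnorm_ge0 ?T_le.
Qed.

(** Factoring out S (t - (s + h)) leaves the difference of the two semigroups
    over the time h, which makes right difference quotients of the
    interpolation those of T and S at 0. *)
Lemma interpolation_step (t s h : R) x : 0 <= s -> 0 <= h -> s + h <= t ->
  S (t - (s + h)) (T (s + h) x) - S (t - s) (T s x)
  = S (t - (s + h)) (T h (T s x) - S h (T s x)).
Proof.
move=> s0 h0 sht; have [_ _ SD _] := S_C0; have [_ _ TD _] := T_C0.
rewrite linearB [s + h]addrC TD // -SD ?subr_ge0 //; last by rewrite addrC.
by congr (_ - S _ _); ring.
Qed.

(** Duhamel's formula
      S (t - b) (T b x) - S (t - a) (T a x)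
        = - \int_a^b S (t - s) (B (T s x)) ds
    as an inequality, with no vector-valued integral.  The bound C is required
    at all later times r, not only at r = t - s, because the factor in
    [interpolation_step] is S (t - (s + h)). *)
Lemma interpolation_lipschitz (t a b C : R) x : 0 <= a <= b -> b <= t -> 0 <= C ->
  (forall s r : R, a < s < b -> t - b <= r -> rnorm (S r (B (T s x))) <= C) ->
  rnorm (S (t - b) (T b x) - S (t - a) (T a x)) <= C * (b - a).
Proof.
move=> /andP [a0 ab] bt C0 SBT.
have [_ S0 SD Sc] := S_C0; have [_ T0 TD Tc] := T_C0.
have TS0 y (e : R) : 0 < e -> \forall h \near 0^'+, rnorm (T h y - S h y) < e.
  move=> e0; have : T h y - S h y @[h --> 0^'+] --> y - y.
    by apply: cvgB; [exact: Tc|exact: Sc].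
  by move=> /rnorm_cvgP /(_ e e0); apply: filterS => h; rewrite subrr subr0.
have [->|a_neq_b] := eqVneq a b; first by rewrite !subrr rnorm0 mulr0.
have altb : a < b by rewrite lt_neqAle a_neq_b.
have MS1 : 0 < MS + 1 by move: MS_ge0; lra.
pose f s := S (t - s) (T s x).
apply: (@mean_value_inequality _ _ f) => //.
- apply/rnorm_cvgP => e e0; near=> h.
  have h0 : 0 < h by near: h; exact: nbhs_right_gt.
  have hb : h < b - a by near: h; apply: nbhs_right_lt; lra.
  rewrite /f interpolation_step; try lra.
  rewrite (le_lt_trans (rnorm_S _ _)); [| lra |].
    by [].
  rewrite (@le_lt_trans _ _ ((MS + 1) * rnorm (T h (T a x) - S h (T a x)))) //.
    by rewrite ler_wpM2r ?rnorm_ge0 // lerDl.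
  rewrite mulrC -ltr_pdivlMr //; near: h; apply: TS0; exact: divr_gt0.
- move=> s /andP [as_ sb]; apply/rnorm_cvgP => e e0.
  (* T h - S h tends to 0 strongly, but is applied to z = T (s - h) x, which
     moves with h; k eta bounds the value at z from the values at y = T s x
     and the distance from z to y. *)
  pose y := T s x; pose k := 1 + (MT + MS) * MT.
  have k0 : 0 < MS * k + 1.
    have := @mulr_ge0 _ MS k MS_ge0.
    by have := mulr_ge0 (addr_ge0 MT_ge0 MS_ge0) MT_ge0; rewrite /k; lra.
  pose eta := e / (MS * k + 1).
  have eta0 : 0 < eta by exact: divr_gt0.
  near=> h.
  have h0 : 0 < h by near: h; exact: nbhs_right_gt.
  have hs : h < s - a by near: h; apply: nbhs_right_lt; lra.
  have step := @interpolation_step t (s - h) h x; rewrite subrK in step.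
  rewrite rnormB /f step; try lra.
  apply: (le_lt_trans (rnorm_S _ _)); first lra.
  set z := T (s - h) x.
  have zy : rnorm (z - y) <= MT * eta.
    have -> : z - y = T (s - h) (x - T h x).
      by rewrite linearB -TD ?subrK //; lra.
    apply: le_trans (rnorm_T _ _) _; first lra.
    rewrite ler_wpM2l // rnormB ltW //; near: h.
    by have /rnorm_cvgP := Tc x; apply.
  have yeta : rnorm (T h y - S h y) <= eta by rewrite ltW //; near: h; exact: TS0.
  have zeta : rnorm (T h z - S h z) <= k * eta.
    have -> : T h z - S h z = (T h y - S h y) + (T h (z - y) - S h (z - y)).
      by rewrite addrACA -opprD -!linearD subrKC.
    apply: le_trans (rnormD _ _) _.
    have := rnormD (T h (z - y)) (- S h (z - y)); rewrite rnormN.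
    have := rnorm_T (z - y) (ltW h0); have := rnorm_S (z - y) (ltW h0).
    have := ler_wpM2l MT_ge0 zy; have := ler_wpM2l MS_ge0 zy.
    rewrite /k; lra.
  have := ler_wpM2l MS_ge0 zeta.
  have : (MS * k + 1) * eta = e by rewrite mulrC divfK // gt_eqF.
  lra.
- move=> s /andP [as_ sb] e e0; pose y := T s x.
  have s0 : 0 < s by lra.
  have /rnorm_cvgP := perturbation_difference_quotient A_gen AB_gen (T_dom x s0).
  move=> /(_ (e / (MS + 1)) (divr_gt0 e0 MS1)); rewrite opprK -/y => quot.
  near=> h.
  have h0 : 0 < h by near: h; exact: nbhs_right_gt.
  have hs : h < b - s by near: h; apply: nbhs_right_lt; lra.
  rewrite /f interpolation_step; try lra.
  pose q := (h^-1)%:C *: (T h y - S h y).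
  have qB : rnorm (q + B y) < e / (MS + 1).
    by rewrite /q; near: h; exact: quot.
  have -> : T h (T s x) - S h (T s x) = h%:C *: (q + B y - B y).
    by rewrite addrK /q scalerA -rmorphM mulfV ?gt_eqF // rmorph1 scale1r.
  have r0 : 0 <= t - (s + h) by lra.
  rewrite linearZ rnormZ gtr0_norm // mulrC ler_wpM2r ?(ltW h0) // linearB.
  apply: le_trans (rnormD _ _) _; rewrite rnormN.
  have := SBT s (t - (s + h)); rewrite as_ sb => /(_ isT ltac:(lra)).
  have := rnorm_S (q + B y) r0; have := ler_wpM2l MS_ge0 (ltW qB).
  have : MS * (e / (MS + 1)) <= e by rewrite mulrA ler_pdivrMr //; lra.
  rewrite -/y; lra.
Unshelve. all: by end_near. Qed.

(** Each of the final value f N and the increments of the interpolation f on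
    [0, d] and [d, N] contributes at most c. *)
Lemma exists_small_opnorm (c N : R) : bounded_operator B ->
  (forall t : R, 0 < t -> compact_operator (B \o T t)) -> strongly_stable S ->
  0 < c -> 0 < N -> MS * opnorm (T N) <= c ->
  exists2 t : R, 0 < t & opnorm (S t) <= 3 * c.
Proof.
move=> Bb BTc Ss c0 N0 TNc.
have [Tb _ TD _] := T_C0.
pose C1 := MS * (opnorm B * MT).
have C1_ge0 : 0 <= C1 by rewrite !mulr_ge0 ?opnorm_ge0.
pose d := Num.min N (c / (C1 + 1)).
have C11 : 0 < C1 + 1 by lra.
have d0 : 0 < d by rewrite lt_min N0 divr_gt0.
have dN : d <= N by rewrite ge_min lexx.
have C1d : C1 * d <= c.
  apply: (@le_trans _ _ ((C1 + 1) * (c / (C1 + 1)))).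
    by apply: ler_pM; rewrite ?(ltW d0) ?lerDl // ge_min lexx orbT.
  by rewrite mulrC divfK // gt_eqF.
have MT1 : 0 < MT + 1 by move: MT_ge0; lra.
pose e := c / (N * (MT + 1)).
have e0 : 0 < e by rewrite divr_gt0 // mulr_gt0.
have [t0 t0_ge0 t0P] := stable_uniformly_on_precompact S_C0 S_le Ss (BTc d d0) e0.
have t_gt0 : 0 < t0 + N by lra.
exists (t0 + N) => //; apply: opnorm_le => x x1.
have head : rnorm (S (t0 + N - d) (T d x) - S (t0 + N - 0) (T 0 x)) <= C1 * (d - 0).
  apply: interpolation_lipschitz => //; [by rewrite lexx ltW|lra|].
  move=> s r /andP [s0 sd] r0; apply: le_trans (rnorm_S _ _) _; first lra.
  rewrite ler_wpM2l // (le_trans (rnorm_le_opnorm _ Bb)) //.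
  rewrite ler_wpM2l ?opnorm_ge0 // (le_trans (rnorm_T _ (ltW s0))) //.
  by rewrite ler_piMr.
have middle : rnorm (S (t0 + N - N) (T N x) - S (t0 + N - d) (T d x))
    <= (MT + 1) * e * (N - d).
  apply: interpolation_lipschitz; [by rewrite ltW|lra|by rewrite mulr_ge0 ?ltW|].
  move=> s r /andP [ds sN]; rewrite addrK => t0r.
  (* B (T s x) is (MT + 1) times the image of u, in the unit ball, under the
     compact operator B \o T d; MT + 1 is used since MT may be 0. *)
  pose u := (MT + 1)^-1%:C *: T (s - d) x.
  have u1 : rnorm u <= 1.
    rewrite rnormZ gtr0_norm ?invr_gt0 // ler_pdivrMl // mulr1.
    have sd0 : 0 <= s - d by lra.
    apply: le_trans (rnorm_T x sd0) _.
    by rewrite (le_trans (ler_piMr _ x1)) // lerDl.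
  have -> : T s x = (MT + 1)%:C *: T d u.
    rewrite -linearZ /u scalerA -rmorphM mulfV ?gt_eqF // rmorph1 scale1r.
    by rewrite -TD ?subrKC //; lra.
  clearbody u; rewrite !linearZ rnormZ gtr0_norm // ler_pM2l //; apply: t0P => //.
  by exists u.
have tail : rnorm (S (t0 + N - N) (T N x)) <= c.
  rewrite addrK (le_trans (rnorm_S _ t0_ge0)) // (le_trans _ TNc) // ler_wpM2l //.
  by apply: opnorm_ub => //; exact/Tb/ltW.
have middle_le : (MT + 1) * e * (N - d) <= c.
  have cE : (MT + 1) * e * N = c by rewrite /e; field; rewrite !gt_eqF.
  rewrite -[leRHS]cE ler_wpM2l ?gerBl ?ltW // mulr_gt0 //.
move: head middle tail; have [_ T0 _ _] := T_C0; rewrite !subr0 T0.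
set f0 := S _ x; set fd := S _ (T d x); set fN := S _ (T N x).
move=> head middle tail.
have := rnormD fN (f0 - fN); rewrite subrKC (rnormB f0).
have := rnormD (fN - fd) (fd - f0); rewrite subrKA; lra.
Qed.

End Comparison.

Unset Implicit Arguments.
Set Strict Implicit.

(* T t is e^{tA}, S t is e^{t(A+B)} *)
Theorem corollary4 (R : realType) (X : completeNormedModType R[i])
    (A : operator X) (T : R -> {linear X -> X})
    (T_C0 : C0_semigroup T) (A_gen : generates A T)
    (T_diff : immediately_differentiable T)
    (T_ues : uniformly_exponentially_stable T)
    (B : {linear X -> X}) (B_bounded : bounded_operator B)
    (BT_compact : forall t : R, 0 < t -> compact_operator (B \o T t))
    (S : R -> {linear X -> X})
    (S_C0 : C0_semigroup S) (AB_gen : generates (add_bounded A B) S) :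
  strongly_stable S -> uniformly_exponentially_stable S.
Proof.
move=> S_stable.
have [MS MS1 S_le] := strongly_stable_bounded S_C0 S_stable.
have [MT [w [MT1 w0 T_decay]]] := T_ues.
have MS0 : 0 <= MS by lra.
have MT0 : 0 <= MT by lra.
have T_le t : 0 <= t -> opnorm (T t) <= MT.
  move=> t0; apply: le_trans (T_decay t t0) _.
  by rewrite ler_piMr // -expR0 ler_expR mulNr oppr_le0 mulr_ge0 // ltW.
have T_dom := immediately_differentiable_dom T_C0 A_gen T_diff.
pose c : R := expR (-1) / 3.
have c0 : 0 < c by rewrite divr_gt0 ?expR_gt0.
(* The time N = y / w gives MS * MT * exp(- w N) <= c since y <= exp y. *)
pose y := MS * MT / c.
have y0 : 0 < y by rewrite divr_gt0 // mulr_gt0; lra.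
have N0 : 0 < y / w by exact: divr_gt0.
have TN : MS * opnorm (T (y / w)) <= c.
  apply: (@le_trans _ _ (MS * (MT * expR (- y)))).
    rewrite ler_wpM2l // (le_trans (T_decay _ (ltW N0))) // mulNr mulrCA.
    by rewrite mulfV ?mulr1 // gt_eqF.
  rewrite mulrA expRN ler_pdivrMr ?expR_gt0 // -ler_pdivrMl // mulrC -/y.
  by rewrite (le_trans _ (expR_ge1Dx y)) // lerDr.
have [t t0 St] := exists_small_opnorm T_C0 S_C0 A_gen AB_gen T_dom MS0 MT0
  S_le T_le B_bounded BT_compact S_stable c0 N0 TN.
apply: (exponentially_stable_of_contraction S_C0 MS1 S_le t0).
by rewrite (le_trans St) // /c mulrC divfK.
Qed.
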